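(* Let $G_1$ and $G_2$ be algebras with bracket (AWB's). Then the following statements are equivalent: (a) $G_1$ and $G_2$ are isoclinic. (b) There exist an AWB $A$ with trivial commutator, a subalgebra $H$ of $G_1\times A$ with $H+Z(G_1\times A)=G_1\times A$, and a two-sided ideal $N$ of $H$ with $N\cap[[H,H]]=0$, such that $H/N$ is isomorphic to $G_2$. (c) There exist an AWB $B$ with trivial commutator, a two-sided ideal $M$ of $G_1\times B$ with $M\cap[[G_1\times B,G_1\times B]]=0$, and a subalgebra $I$ of $(G_1\times B)/M$ with $I+Z((G_1\times B)/M)=(G_1\times B)/M$, such that $I$ is isomorphic to $G_2$.
   Context: Fix a ground field $\mathbb{K}$. An algebra with bracket (AWB) is an associative (not necessarily commutative, not necessarily unital) $\mathbb{K}$-algebra $A$ with a bilinear map $[-,-]:A\times A\to A$ satisfying $[ab,c]=[a,c]b+a[b,c]$ for all $a,b,c\in A$. Homomorphisms of AWB's are $\mathbb{K}$-linear maps preserving product and bracket. Products $A\times B$ have componentwise operations. A subalgebra is a subspace closed under product and bracket; a two-sided ideal of $A$ is a subspace $I$ with $AI,IA,[A,I],[I,A]\subseteq I$. $[[A,A]]$ denotes the two-sided ideal of $A$ spanned by all $ab$ and $[a,b]$, $a,b\in A$; $A$ has trivial commutator if $[[A,A]]=0$. The center is $Z(A)=\{a\in A: ab=ba=0,\ [a,b]=[b,a]=0\ \forall b\in A\}$. Two AWB's $G_1,G_2$ are isoclinic if there are AWB isomorphisms $\eta:G_1/Z(G_1)\to G_2/Z(G_2)$ and $\xi:[[G_1,G_1]]\to[[G_2,G_2]]$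 such that whenever $g,g'\in G_1$, $h,h'\in G_2$ satisfy $\eta(g+Z(G_1))=h+Z(G_2)$ and $\eta(g'+Z(G_1))=h'+Z(G_2)$, one has $\xi([g,g'])=[h,h']$ and $\xi(gg')=hh'$. *)

(* Defs.v *)
From HB Require Import structures.
From mathcomp Require Import all_boot all_order all_algebra.
From mathcomp Require Import ring_quotient.
From mathcomp Require Import boolp classical_sets.

Set Implicit Arguments.
Unset Strict Implicit.
Unset Printing Implicit Defensive.

Import GRing.Theory.

Local Open Scope ring_scope.
Local Open Scope classical_set_scope.
Local Open Scope quotient_scope.

(* The product is not assumed unital, so none of the ring structures of
   ssralg applies: it is a separate operation on an lmodType. *)
HB.mixin Record Lmodule_isAWB (K : fieldType) A of GRing.Lmodule K A := {
  amul : A -> A -> A;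
  abr : A -> A -> A;
  amul_bilinear : bilinear_for *:%R *:%R amul;
  abr_bilinear : bilinear_for *:%R *:%R abr;
  amulA : associative amul;
  abrM : forall a b c, abr (amul a b) c = amul (abr a c) b + amul a (abr b c)
}.

#[short(type="awbType")]
HB.structure Definition AWB (K : fieldType) :=
  {A of GRing.Lmodule K A & Lmodule_isAWB K A}.

Section Basics.
Context {K : fieldType} {A : awbType K}.
Implicit Types (a b c : A) (k : K).

Lemma amulDl a b c : amul (a + b) c = amul a c + amul b c.
Proof. by have := (@amul_bilinear K A).1 c 1 a b; rewrite /= !scale1r. Qed.
Lemma amulDr a b c : amul c (a + b) = amul c a + amul c b.
Proof. by have := (@amul_bilinear K A).2 c 1 a b; rewrite /= !scale1r. Qed.
Lemma abrDl a b c : abr (a + b) c = abr a c + abr b c.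
Proof. by have := (@abr_bilinear K A).1 c 1 a b; rewrite /= !scale1r. Qed.
Lemma abrDr a b c : abr c (a + b) = abr c a + abr c b.
Proof. by have := (@abr_bilinear K A).2 c 1 a b; rewrite /= !scale1r. Qed.

Lemma amul0l a : amul 0 a = 0.
Proof. by apply: (addrI (amul 0 a)); rewrite -amulDl !addr0. Qed.
Lemma amul0r a : amul a 0 = 0.
Proof. by apply: (addrI (amul a 0)); rewrite -amulDr !addr0. Qed.
Lemma abr0l a : abr 0 a = 0.
Proof. by apply: (addrI (abr 0 a)); rewrite -abrDl !addr0. Qed.
Lemma abr0r a : abr a 0 = 0.
Proof. by apply: (addrI (abr a 0)); rewrite -abrDr !addr0. Qed.

Lemma amulZl k a b : amul (k *: a) b = k *: amul a b.
Proof. by have := (@amul_bilinear K A).1 b k a 0; rewrite /= amul0l !addr0. Qed.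
Lemma amulZr k a b : amul a (k *: b) = k *: amul a b.
Proof. by have := (@amul_bilinear K A).2 a k b 0; rewrite /= amul0r !addr0. Qed.
Lemma abrZl k a b : abr (k *: a) b = k *: abr a b.
Proof. by have := (@abr_bilinear K A).1 b k a 0; rewrite /= abr0l !addr0. Qed.
Lemma abrZr k a b : abr a (k *: b) = k *: abr a b.
Proof. by have := (@abr_bilinear K A).2 a k b 0; rewrite /= abr0r !addr0. Qed.

Lemma amulNl a b : amul (- a) b = - amul a b.
Proof. by rewrite -scaleN1r amulZl scaleN1r. Qed.
Lemma amulNr a b : amul a (- b) = - amul a b.
Proof. by rewrite -scaleN1r amulZr scaleN1r. Qed.
Lemma abrNl a b : abr (- a) b = - abr a b.
Proof. by rewrite -scaleN1r abrZl scaleN1r. Qed.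
Lemma abrNr a b : abr a (- b) = - abr a b.
Proof. by rewrite -scaleN1r abrZr scaleN1r. Qed.
End Basics.

Definition awb_hom (K : fieldType) (A B : awbType K) (f : A -> B) : Prop :=
  [/\ linear f, {morph f : a b / amul a b} & {morph f : a b / abr a b}].

Definition awb_iso (K : fieldType) (A B : awbType K) (f : A -> B) : Prop :=
  awb_hom f /\ bijective f.

Definition awb_isomorphic (K : fieldType) (A B : awbType K) : Prop :=
  exists f : A -> B, awb_iso f.

Section Product.
Context {K : fieldType} {A B : awbType K}.

Definition prod_amul (x y : A * B) : A * B := (amul x.1 y.1, amul x.2 y.2).
Definition prod_abr (x y : A * B) : A * B := (abr x.1 y.1, abr x.2 y.2).

Lemma prod_amul_bilinear : bilinear_for *:%R *:%R prod_amul.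
Proof.
split=> z k x y; rewrite /prod_amul /=;
  by rewrite ?amulDl ?amulDr ?amulZl ?amulZr.
Qed.

Lemma prod_abr_bilinear : bilinear_for *:%R *:%R prod_abr.
Proof.
split=> z k x y; rewrite /prod_abr /=;
  by rewrite ?abrDl ?abrDr ?abrZl ?abrZr.
Qed.

Lemma prod_amulA : associative prod_amul.
Proof. by move=> x y z; rewrite /prod_amul /= !amulA. Qed.

Lemma prod_abrM x y z : prod_abr (prod_amul x y) z =
  prod_amul (prod_abr x z) y + prod_amul x (prod_abr y z).
Proof. by rewrite /prod_abr /prod_amul /= !abrM. Qed.

HB.instance Definition _ := Lmodule_isAWB.Build K (A * B)%type
  prod_amul_bilinear prod_abr_bilinear prod_amulA prod_abrM.
End Product.

Definition is_subspace (K : fieldType) (V : lmodType K) (S : set V) : Prop :=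
  S 0 /\ forall k x y, S x -> S y -> S (k *: x + y).

Record subalgebra (K : fieldType) (A : awbType K) := Subalgebra {
  subalg_set :> set A;
  subalg_subspace : is_subspace subalg_set;
  subalg_mul : forall a b, subalg_set a -> subalg_set b -> subalg_set (amul a b);
  subalg_br : forall a b, subalg_set a -> subalg_set b -> subalg_set (abr a b)
}.

Record ideal (K : fieldType) (A : awbType K) := Ideal {
  ideal_set : set A;
  ideal_subspace : is_subspace ideal_set;
  ideal_mull : forall a x, ideal_set x -> ideal_set (amul a x);
  ideal_mulr : forall a x, ideal_set x -> ideal_set (amul x a);
  ideal_brl : forall a x, ideal_set x -> ideal_set (abr a x);
  ideal_brr : forall a x, ideal_set x -> ideal_set (abr x a)
}.

Coercion subalg_of_ideal (K : fieldType) (A : awbType K) (N : ideal A)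
    : subalgebra A :=
  Subalgebra (ideal_subspace N) (fun a b _ => @ideal_mull K A N a b)
    (fun a b _ => @ideal_brl K A N a b).

Definition sumset (K : fieldType) (V : lmodType K) (S T : set V) : set V :=
  [set s + t | s in S & t in T].

Section SubType.
Context {K : fieldType} {A : awbType K} (H : subalgebra A).

Definition subalg_pred : {pred A} := fun x => x \in (H : set A).

Lemma subalg_predE x : (x \in subalg_pred) = (x \in (H : set A)).
Proof. by []. Qed.

Lemma subalg_pred_submod_closed : submod_closed subalg_pred.
Proof.
have [H0 Hlin] := subalg_subspace H.
split; first by rewrite subalg_predE inE.
by move=> k x y; rewrite !subalg_predE !inE; apply: Hlin.
Qed.

HB.instance Definition _ :=
  GRing.isSubmodClosed.Build K A subalg_pred subalg_pred_submod_closed.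

Definition awb_sub : Type := {x : A | x \in subalg_pred}.

HB.instance Definition _ := SubChoice.on awb_sub.
HB.instance Definition _ := [SubChoice_isSubLmodule of awb_sub by <:].

Lemma awb_subP (x : awb_sub) : subalg_set H (val x).
Proof. by have := valP x; rewrite subalg_predE inE. Qed.

Definition sub_elt (a : A) (Ha : subalg_set H a) : awb_sub :=
  exist (fun x => x \in subalg_pred) a (mem_set Ha).

Definition sub_amul (x y : awb_sub) : awb_sub :=
  sub_elt (subalg_mul (awb_subP x) (awb_subP y)).
Definition sub_abr (x y : awb_sub) : awb_sub :=
  sub_elt (subalg_br (awb_subP x) (awb_subP y)).

Lemma val_sub_amul x y : val (sub_amul x y) = amul (val x) (val y).
Proof. by []. Qed.
Lemma val_sub_abr x y : val (sub_abr x y) = abr (val x) (val y).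
Proof. by []. Qed.

Lemma sub_amul_bilinear : bilinear_for *:%R *:%R sub_amul.
Proof.
split=> z k x y; apply: val_inj; rewrite [in RHS]linearP !val_sub_amul linearP;
  by rewrite ?(amulDl, amulDr) ?(amulZl, amulZr).
Qed.

Lemma sub_abr_bilinear : bilinear_for *:%R *:%R sub_abr.
Proof.
split=> z k x y; apply: val_inj; rewrite [in RHS]linearP !val_sub_abr linearP;
  by rewrite ?(abrDl, abrDr) ?(abrZl, abrZr).
Qed.

Lemma sub_amulA : associative sub_amul.
Proof. by move=> x y z; apply: val_inj; rewrite !val_sub_amul amulA. Qed.

Lemma sub_abrM x y z : sub_abr (sub_amul x y) z =
  sub_amul (sub_abr x z) y + sub_amul x (sub_abr y z).
Proof.
by apply: val_inj; rewrite raddfD /= ?(val_sub_amul, val_sub_abr) abrM.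
Qed.

HB.instance Definition _ := Lmodule_isAWB.Build K awb_sub
  sub_amul_bilinear sub_abr_bilinear sub_amulA sub_abrM.
End SubType.

Section Quotient.
Context {K : fieldType} {A : awbType K} (N : ideal A).
Implicit Types (k : K) (a b : A).

Definition awb_quot : Type := Quotient.quot (subalg_pred N).

HB.instance Definition _ := GRing.Zmodule.on awb_quot.
HB.instance Definition _ := EqQuotient.on awb_quot.

Definition coset (a : A) : awb_quot := \pi_awb_quot a.

Lemma coset_eqP a b : coset a = coset b <-> ideal_set N (a - b).
Proof.
have E : (a - b \in subalg_pred N) = (coset a == coset b).
  by rewrite Quotient.idealrBE.
split=> [/eqP|Nab]; first by rewrite -E subalg_predE inE.
by apply/eqP; rewrite -E subalg_predE inE.
Qed.

Lemma coset_repr (u : awb_quot) : coset (repr u) = u.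
Proof. exact: reprK. Qed.

Lemma coset_ind (P : awb_quot -> Prop) : (forall a, P (coset a)) -> forall u, P u.
Proof. by move=> Pa u; rewrite -[u]coset_repr. Qed.

Lemma cosetD a b : coset (a + b) = coset a + coset b.
Proof. by rewrite /coset !piE. Qed.

Definition quot_scale k (u : awb_quot) : awb_quot := coset (k *: repr u).
Definition quot_amul (u v : awb_quot) : awb_quot := coset (amul (repr u) (repr v)).
Definition quot_abr (u v : awb_quot) : awb_quot := coset (abr (repr u) (repr v)).

Lemma ideal_repr a : ideal_set N (repr (coset a) - a).
Proof. by apply/coset_eqP; rewrite coset_repr. Qed.

Lemma ideal_add a b : ideal_set N a -> ideal_set N b -> ideal_set N (a + b).
Proof.
by move=> Na Nb; rewrite -[a]scale1r; apply: (ideal_subspace N).2.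
Qed.

Lemma quot_scaleE k a : quot_scale k (coset a) = coset (k *: a).
Proof.
apply/coset_eqP; rewrite -scalerBr -[_ *: _]addr0.
by apply: (ideal_subspace N).2; [apply: ideal_repr | apply: (ideal_subspace N).1].
Qed.

Lemma quot_amulE a b : quot_amul (coset a) (coset b) = coset (amul a b).
Proof.
apply/coset_eqP; set a' := repr _; set b' := repr _.
have -> : amul a' b' - amul a b = amul (a' - a) b' + amul a (b' - b).
  by rewrite amulDl amulDr amulNl amulNr addrA subrK.
by apply: ideal_add; [apply: ideal_mulr | apply: ideal_mull]; apply: ideal_repr.
Qed.

Lemma quot_abrE a b : quot_abr (coset a) (coset b) = coset (abr a b).
Proof.
apply/coset_eqP; set a' := repr _; set b' := repr _.
have -> : abr a' b' - abr a b = abr (a' - a) b' + abr a (b' - b).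
  by rewrite abrDl abrDr abrNl abrNr addrA subrK.
by apply: ideal_add; [apply: ideal_brr | apply: ideal_brl]; apply: ideal_repr.
Qed.

Lemma quot_scalerA k l u : quot_scale k (quot_scale l u) = quot_scale (k * l) u.
Proof. by elim/coset_ind: u => a; rewrite !quot_scaleE scalerA. Qed.

Lemma quot_scale1r : left_id 1 quot_scale.
Proof. by elim/coset_ind=> a; rewrite quot_scaleE scale1r. Qed.

Lemma quot_scalerDr : right_distributive quot_scale +%R.
Proof.
move=> k; elim/coset_ind=> a; elim/coset_ind=> b.
by rewrite -cosetD !quot_scaleE -cosetD scalerDr.
Qed.

Lemma quot_scalerDl u : {morph quot_scale^~ u : k l / k + l}.
Proof.
by elim/coset_ind: u => a k l; rewrite !quot_scaleE -cosetD scalerDl.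
Qed.

HB.instance Definition _ := GRing.Zmodule_isLmodule.Build K awb_quot
  quot_scalerA quot_scale1r quot_scalerDr quot_scalerDl.

Lemma cosetZ k a : coset (k *: a) = k *: coset a.
Proof. by rewrite -quot_scaleE. Qed.

Lemma quot_amul_bilinear : bilinear_for *:%R *:%R quot_amul.
Proof.
split; elim/coset_ind=> c k; elim/coset_ind=> a; elim/coset_ind=> b;
  rewrite -cosetZ -cosetD /= !quot_amulE -cosetZ -cosetD;
  by rewrite ?(amulDl, amulDr) ?(amulZl, amulZr).
Qed.

Lemma quot_abr_bilinear : bilinear_for *:%R *:%R quot_abr.
Proof.
split; elim/coset_ind=> c k; elim/coset_ind=> a; elim/coset_ind=> b;
  rewrite -cosetZ -cosetD /= !quot_abrE -cosetZ -cosetD;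
  by rewrite ?(abrDl, abrDr) ?(abrZl, abrZr).
Qed.

Lemma quot_amulA : associative quot_amul.
Proof.
elim/coset_ind=> a; elim/coset_ind=> b; elim/coset_ind=> c.
by rewrite !quot_amulE amulA.
Qed.

Lemma quot_abrM u v w : quot_abr (quot_amul u v) w =
  quot_amul (quot_abr u w) v + quot_amul u (quot_abr v w).
Proof.
elim/coset_ind: u => a; elim/coset_ind: v => b; elim/coset_ind: w => c.
by rewrite !(quot_amulE, quot_abrE) -cosetD abrM.
Qed.

HB.instance Definition _ := Lmodule_isAWB.Build K awb_quot
  quot_amul_bilinear quot_abr_bilinear quot_amulA quot_abrM.

Lemma coset_hom : awb_hom coset.
Proof.
split=> [k a b|a b|a b]; first by rewrite cosetD cosetZ.
- by rewrite -quot_amulE.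
- by rewrite -quot_abrE.
Qed.
End Quotient.

Section Center.
Context {K : fieldType} (A : awbType K).

Definition center_set : set A := [set a |
  forall b : A, [/\ amul a b = 0, amul b a = 0, abr a b = 0 & abr b a = 0]].

Lemma center_subspace : is_subspace center_set.
Proof.
split=> [b|k x y Zx Zy b]; first by rewrite !(amul0l, amul0r, abr0l, abr0r).
have [x1 x2 x3 x4] := Zx b; have [y1 y2 y3 y4] := Zy b.
rewrite amulDl amulDr abrDl abrDr amulZl amulZr abrZl abrZr.
by rewrite x1 x2 x3 x4 y1 y2 y3 y4 !scaler0 !addr0.
Qed.

Lemma center_mull a x : center_set x -> center_set (amul a x).
Proof. by move=> Zx; have [_ -> _ _] := Zx a; apply: center_subspace.1. Qed.
Lemma center_mulr a x : center_set x -> center_set (amul x a).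
Proof. by move=> Zx; have [-> _ _ _] := Zx a; apply: center_subspace.1. Qed.
Lemma center_brl a x : center_set x -> center_set (abr a x).
Proof. by move=> Zx; have [_ _ _ ->] := Zx a; apply: center_subspace.1. Qed.
Lemma center_brr a x : center_set x -> center_set (abr x a).
Proof. by move=> Zx; have [_ _ -> _] := Zx a; apply: center_subspace.1. Qed.

Definition center : ideal A :=
  Ideal center_subspace center_mull center_mulr center_brl center_brr.
End Center.

Section Commutator.
Context {K : fieldType} (A : awbType K).

(* The linear span of all products and brackets: since it contains every
   product and bracket, it is already a two-sided ideal. *)
Definition commutator_set : set A :=
  smallest (@is_subspace K A)
    [set x | exists a b : A, x = amul a b \/ x = abr a b].

Lemma amul_commutator a b : commutator_set (amul a b).
Proof. by move=> S [_]; apply; exists a, b; left. Qed.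

Lemma abr_commutator a b : commutator_set (abr a b).
Proof. by move=> S [_]; apply; exists a, b; right. Qed.

Lemma commutator_subspace : is_subspace commutator_set.
Proof.
split=> [S [[S0 _] _] //|k x y Cx Cy S SP].
by apply: SP.1.2; [apply: Cx | apply: Cy].
Qed.

Definition commutator : ideal A :=
  Ideal commutator_subspace
    (fun a x _ => amul_commutator a x) (fun a x _ => amul_commutator x a)
    (fun a x _ => abr_commutator a x) (fun a x _ => abr_commutator x a).

Definition comm_amul (a b : A) : awb_sub commutator :=
  @sub_elt K A commutator (amul a b) (amul_commutator a b).
Definition comm_abr (a b : A) : awb_sub commutator :=
  @sub_elt K A commutator (abr a b) (abr_commutator a b).

Definition trivial_commutator : Prop := (commutator : set A) = [set 0].
End Commutator.

Definition isoclinic (K : fieldType) (G1 G2 : awbType K) : Prop :=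
  exists (eta : awb_quot (center G1) -> awb_quot (center G2))
         (xi : awb_sub (commutator G1) -> awb_sub (commutator G2)),
    [/\ awb_iso eta, awb_iso xi &
      forall (g g' : G1) (h h' : G2),
        eta (coset (center G1) g) = coset (center G2) h ->
        eta (coset (center G1) g') = coset (center G2) h' ->
        xi (comm_abr g g') = comm_abr h h' /\
        xi (comm_amul g g') = comm_amul h h'].

(* Main.v *)
Require Import Defs.
From HB Require Import structures.
From mathcomp Require Import all_boot all_order all_algebra.
From mathcomp Require Import boolp classical_sets.

Set Implicit Arguments.
Unset Strict Implicit.
Unset Printing Implicit Defensive.

Import GRing.Theory.

(** Everything is expressed by spans.  Call surjective homomorphisms
    [p : P -> G1] and [q : P -> G2] an isoclinic span when [p] and [q] vanish
    at the same elements of [[P,P]].  Such a span exists exactly when [G1] and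
    [G2] are isoclinic.

    Given the span, an element [w] of [P] has [p w] central iff
    [p] kills all products and brackets of [w], iff [q] does, iff [q w] is
    central; hence [G1/Z(G1)] and [G2/Z(G2)] are both the quotient of [P] by
    the same ideal, and likewise [[G1,G1]] and [[G2,G2]] are both the quotient
    of [[P,P]] by the same ideal ([isoclinic_of_span]).  Conversely an
    isoclinism yields the fibre product of [G1] and [G2] over
    [G1/Z(G1) = G2/Z(G2)], whose commutator is the graph of [xi]
    ([span_of_isoclinic]).

    (a) => (b): for a span [p, q] put [A := P/[[P,P]]] and let [H] be the image
    of [w |-> (p w, w + [[P,P]])].  The kernel of this map lies in the kernel
    of [q], so [q] factors through [H]; the kernel [N] of the factor [H -> G2]
    meets [[H,H]] trivially by the defining property of the span
    ([isoclinic_subquotient]).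

    (b) => (c): an ideal [N] of [H] with [N] and [[H,H]] meeting trivially is
    central in [H], hence central in the whole algebra [H + Z].  So [N] is
    already an ideal of the whole algebra, which has the same commutator as
    [H], and one takes [M := N], [I := H/N] ([quotient_subalgebra]).

    (c) => (a): the pairs [(x, i)] of [(G1 x B) x I] such that [x + M] and [i]
    differ by a central element form an algebra, and its maps to [G1] and to
    [I = G2] are an isoclinic span ([isoclinic_of_quotient_subalgebra]). *)

Local Open Scope ring_scope.
Local Open Scope classical_set_scope.

Local Notation commutator_of A := (@commutator_set _ A).
Local Notation center_of A := (@center_set _ A).

(** * Homomorphisms and isomorphisms from spans *)

Section Homomorphisms.
Context {K : fieldType}.
Implicit Types A B C : awbType K.

Definition surj A B (f : A -> B) : Prop := forall y, exists x, f x = y.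

Lemma hom0 A B (f : A -> B) : awb_hom f -> f 0 = 0.
Proof.
by case=> lf _ _; have := lf (-1) 0 0; rewrite scaler0 addr0 scaleN1r addNr.
Qed.

Lemma homD A B (f : A -> B) : awb_hom f -> {morph f : x y / x + y}.
Proof. by case=> lf _ _ x y; have := lf 1 x y; rewrite !scale1r. Qed.

Lemma homB A B (f : A -> B) : awb_hom f -> {morph f : x y / x - y}.
Proof.
by case=> lf _ _ x y; have := lf (-1) y x; rewrite !scaleN1r ![- _ + _]addrC.
Qed.

Lemma comp_hom A B C (g : B -> C) (f : A -> B) :
  awb_hom g -> awb_hom f -> awb_hom (g \o f).
Proof.
by move=> [g1 g2 g3] [f1 f2 f3]; split=> [k x y|x y|x y] /=;
  rewrite (f1, f2, f3) (g1, g2, g3).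
Qed.

Lemma pair_hom A B C (f : A -> B) (g : A -> C) :
  awb_hom f -> awb_hom g -> awb_hom (fun x => (f x, g x)).
Proof.
by move=> [f1 f2 f3] [g1 g2 g3]; split=> [k x y|x y|x y];
  rewrite (f1, f2, f3) (g1, g2, g3).
Qed.

Lemma fst_hom A B : awb_hom (fst : A * B -> A).
Proof. by []. Qed.

Lemma snd_hom A B : awb_hom (snd : A * B -> B).
Proof. by []. Qed.

Lemma val_hom A (H : subalgebra A) : awb_hom (val : awb_sub H -> A).
Proof. by split=> // k x y; rewrite linearP. Qed.

Lemma coset_eq0 A (N : ideal A) x : coset N x = 0 <-> ideal_set N x.
Proof. by rewrite -(hom0 (coset_hom N)) coset_eqP subr0. Qed.

Lemma coset_surj A (N : ideal A) : surj (coset N).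
Proof. by move=> u; exists (repr u); rewrite coset_repr. Qed.

Lemma awb_isomorphic_trans A B C :
  awb_isomorphic A B -> awb_isomorphic B C -> awb_isomorphic A C.
Proof.
move=> [f [hf bf]] [g [hg bg]]; exists (g \o f); split; last exact: bij_comp.
exact: comp_hom.
Qed.

(** All the isomorphisms needed are obtained from this form of the first
    isomorphism theorem: [A] and [B] are the quotient of [P] by one ideal. *)
Lemma iso_of_span (P : awbType K) A B (p : P -> A) (q : P -> B) :
  awb_hom p -> awb_hom q -> surj p -> surj q ->
  (forall w, p w = 0 <-> q w = 0) ->
  exists f : A -> B, awb_iso f /\ forall w, f (p w) = q w.
Proof.
move=> hp hq /choice[s ps] /choice[t qt] pq0.
have pq w w' : p w = p w' <-> q w = q w'.
  by split=> /eqP; rewrite -subr_eq0 -homB // => /eqP/pq0;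
    rewrite homB // => /subr0_eq.
have fp w : q (s (p w)) = q w by apply/pq; rewrite ps.
exists (q \o s); split=> //; split; last first.
  exists (p \o t) => [x|y] /=; last by rewrite fp qt.
  by rewrite -[RHS]ps; apply/pq; rewrite qt.
have [p1 p2 p3] := hp; have [q1 q2 q3] := hq.
split=> [k x y|x y|x y] /=; rewrite -{1}[x]ps -{1}[y]ps.
- by rewrite -p1 fp q1.
- by rewrite -p2 fp q2.
- by rewrite -p3 fp q3.
Qed.

End Homomorphisms.

(** * Images and kernels *)

Section Images.
Context {K : fieldType} {A B : awbType K} (f : A -> B) (hf : awb_hom f).

Lemma image_subspace (S : set A) : is_subspace S -> is_subspace (f @` S).
Proof.
have [f1 _ _] := hf; move=> [S0 Sl]; split; first by exists 0; rewrite ?hom0.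
by move=> k _ _ [x Sx <-] [y Sy <-]; exists (k *: x + y); [apply: Sl|rewrite f1].
Qed.

Lemma preimage_subspace (S : set B) : is_subspace S -> is_subspace (f @^-1` S).
Proof.
have [f1 _ _] := hf; move=> [S0 Sl]; split; first by rewrite /preimage /= hom0.
by move=> k x y; rewrite /preimage /= f1; apply: Sl.
Qed.

Lemma setT_subspace : is_subspace [set: A].
Proof. by []. Qed.

Lemma set0_subspace : is_subspace [set 0 : B].
Proof. by split=> // k x y -> ->; rewrite scaler0 addr0. Qed.

Lemma range_mul x y : range f x -> range f y -> range f (amul x y).
Proof. by have [_ f2 _] := hf; move=> [a _ <-] [b _ <-]; exists (amul a b). Qed.

Lemma range_br x y : range f x -> range f y -> range f (abr x y).
Proof. by have [_ _ f3] := hf; move=> [a _ <-] [b _ <-]; exists (abr a b). Qed.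

Definition range_subalg : subalgebra B :=
  Subalgebra (image_subspace setT_subspace) range_mul range_br.

Lemma corestr_proof x : subalg_set range_subalg (f x).
Proof. by exists x. Qed.

Definition corestr (x : A) : awb_sub range_subalg := sub_elt (corestr_proof x).

Lemma corestr_hom : awb_hom corestr.
Proof.
have [f1 f2 f3] := hf.
split=> [k x y|x y|x y]; apply: val_inj;
 by rewrite ?linearP /= (f1, f2, f3).
Qed.

Lemma corestr_surj : surj corestr.
Proof. by move=> u; have [x _ fx] := awb_subP u; exists x; apply: val_inj. Qed.

Lemma ker_mull a x : f x = 0 -> f (amul a x) = 0.
Proof. by have [_ -> _] := hf; move=> ->; rewrite amul0r. Qed.
Lemma ker_mulr a x : f x = 0 -> f (amul x a) = 0.
Proof. by have [_ -> _] := hf; move=> ->; rewrite amul0l. Qed.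
Lemma ker_brl a x : f x = 0 -> f (abr a x) = 0.
Proof. by have [_ _ ->] := hf; move=> ->; rewrite abr0r. Qed.
Lemma ker_brr a x : f x = 0 -> f (abr x a) = 0.
Proof. by have [_ _ ->] := hf; move=> ->; rewrite abr0l. Qed.

Definition ker_ideal : ideal A :=
  Ideal (preimage_subspace set0_subspace) ker_mull ker_mulr ker_brl ker_brr.

Section ImageIdeal.
Variables (sf : surj f) (N : ideal A).
Let S : set B := f @` ideal_set N.

Lemma image_mull a x : S x -> S (amul a x).
Proof.
have [_ f2 _] := hf; have [b <-] := sf a; case=> y Ny <-; exists (amul b y) => //.
exact: ideal_mull.
Qed.
Lemma image_mulr a x : S x -> S (amul x a).
Proof.
have [_ f2 _] := hf; have [b <-] := sf a; case=> y Ny <-; exists (amul y b) => //.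
exact: ideal_mulr.
Qed.
Lemma image_brl a x : S x -> S (abr a x).
Proof.
have [_ _ f3] := hf; have [b <-] := sf a; case=> y Ny <-; exists (abr b y) => //.
exact: ideal_brl.
Qed.
Lemma image_brr a x : S x -> S (abr x a).
Proof.
have [_ _ f3] := hf; have [b <-] := sf a; case=> y Ny <-; exists (abr y b) => //.
exact: ideal_brr.
Qed.

Definition image_ideal : ideal B :=
  Ideal (image_subspace (ideal_subspace N))
    image_mull image_mulr image_brl image_brr.
End ImageIdeal.

End Images.

(** * The commutator ideal *)

Section Commutator.
Context {K : fieldType}.
Implicit Types A B : awbType K.

(** Induction over the linear span: this is how every property of commutator
    elements is established below. *)
Lemma commutator_sub A (S : set A) : is_subspace S ->
  (forall a b, S (amul a b)) -> (forall a b, S (abr a b)) ->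
  commutator_of A `<=` S.
Proof.
by move=> sS Sm Sb x; apply; split=> // _ [a [b [->|->]]].
Qed.

Lemma hom_commutator A B (f : A -> B) x :
  awb_hom f -> commutator_of A x -> commutator_of B (f x).
Proof.
move=> hf; have [_ f2 f3] := hf; move: x; apply: commutator_sub => [|a b|a b].
- exact/(preimage_subspace hf)/commutator_subspace.
- by rewrite /preimage /= f2; apply: amul_commutator.
- by rewrite /preimage /= f3; apply: abr_commutator.
Qed.

Lemma surj_commutator A B (f : A -> B) : awb_hom f -> surj f ->
  commutator_of B `<=` f @` commutator_of A.
Proof.
move=> hf sf; have [_ f2 f3] := hf; apply: commutator_sub => [|a b|a b].
- exact/(image_subspace hf)/commutator_subspace.
- have [x <-] := sf a; have [y <-] := sf b; rewrite -f2.
  by exists (amul x y) => //; apply: amul_commutator.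
- have [x <-] := sf a; have [y <-] := sf b; rewrite -f3.
  by exists (abr x y) => //; apply: abr_commutator.
Qed.

Lemma trivial_commutatorP A :
  trivial_commutator A <-> (forall a b : A, amul a b = 0 /\ abr a b = 0).
Proof.
split=> [tA a b|t0].
  have sub0 x : commutator_of A x -> x = 0.
    by rewrite -[commutator_of A]/(commutator A : set A) tA.
  by split; apply: sub0; [apply: amul_commutator | apply: abr_commutator].
rewrite /trivial_commutator; apply/seteqP; split; last first.
  by move=> _ ->; apply: (commutator_subspace A).1.
apply: commutator_sub => [|a b|a b]; first exact: set0_subspace.
  exact: (t0 a b).1.
exact: (t0 a b).2.
Qed.

Lemma quot_commutator_trivial A : trivial_commutator (awb_quot (commutator A)).
Proof.
apply/trivial_commutatorP=> u v.
have [a <-] := coset_surj u; have [b <-] := coset_surj v.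
have [_ <- <-] := coset_hom (commutator A).
by split; apply/coset_eq0; [apply: amul_commutator | apply: abr_commutator].
Qed.

Section Restriction.
Variables (A B : awbType K) (f : A -> B) (hf : awb_hom f).

Definition comm_map (c : awb_sub (commutator A)) : awb_sub (commutator B) :=
  @sub_elt K B (commutator B) (f (val c)) (hom_commutator hf (awb_subP c)).

Lemma comm_map_hom : awb_hom comm_map.
Proof.
have [f1 f2 f3] := hf.
split=> [k x y|x y|x y]; apply: val_inj; by rewrite ?linearP /= ?linearP (f1, f2, f3).
Qed.

Lemma comm_map_surj : surj f -> surj comm_map.
Proof.
move=> sf d; have [c Cc fc] := surj_commutator hf sf (awb_subP d).
by exists (@sub_elt K A (commutator A) c Cc); apply: val_inj.
Qed.
End Restriction.

End Commutator.

(** * The center *)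

Section Center.
Context {K : fieldType} {A : awbType K}.

(** Product and bracket only see elements modulo the center. *)
Lemma center_ops (x y z t : A) : center_of A z -> center_of A t ->
  amul (x + z) (y + t) = amul x y /\ abr (x + z) (y + t) = abr x y.
Proof.
move=> Zz Zt; have [tx _ bx _] := Zz (y + t); have [_ xt _ bt] := Zt x.
by rewrite amulDl abrDl tx bx !addr0 amulDr abrDr xt bt !addr0.
Qed.

Section CentralIdeal.
Variables (S : set A) (sS : is_subspace S) (SZ : S `<=` center_of A).

Lemma central_mull a x : S x -> S (amul a x).
Proof. by move=> /SZ/(_ a)[_ -> _ _]; apply: sS.1. Qed.
Lemma central_mulr a x : S x -> S (amul x a).
Proof. by move=> /SZ/(_ a)[-> _ _ _]; apply: sS.1. Qed.
Lemma central_brl a x : S x -> S (abr a x).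
Proof. by move=> /SZ/(_ a)[_ _ _ ->]; apply: sS.1. Qed.
Lemma central_brr a x : S x -> S (abr x a).
Proof. by move=> /SZ/(_ a)[_ _ -> _]; apply: sS.1. Qed.

Definition central_ideal : ideal A :=
  Ideal sS central_mull central_mulr central_brl central_brr.
End CentralIdeal.

Lemma surj_center (B : awbType K) (f : A -> B) x :
  awb_hom f -> surj f -> center_of A x -> center_of B (f x).
Proof.
move=> hf sf Zx b; have [_ f2 f3] := hf; have [y <-] := sf b.
by have [xy yx bxy byx] := Zx y; rewrite -!f2 -!f3 xy yx bxy byx (hom0 hf).
Qed.

(** Products and brackets with an element of [N] are both in [N] and in the
    commutator. *)
Lemma trivial_ideal_central (N : ideal A) :
  N `&` commutator A = [set 0] -> ideal_set N `<=` center_of A.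
Proof.
move=> N0 x Nx b.
have eq0 y : ideal_set N y -> commutator_of A y -> y = 0.
  by move=> Ny Cy; have : (N `&` commutator A) y by []; rewrite N0.
split; apply: eq0; try exact: amul_commutator; try exact: abr_commutator.
- exact: ideal_mulr.
- exact: ideal_mull.
- exact: ideal_brr.
- exact: ideal_brl.
Qed.

End Center.

(** * Subalgebras supplementing the center *)

Section Supplement.
Context {K : fieldType} (X : awbType K) (H : subalgebra X).
Hypothesis HZ : sumset H (center X) = [set: X].

Lemma supplement_dec x : exists (h : awb_sub H) z, center_of X z /\ x = val h + z.
Proof.
have : sumset H (center X) x by rewrite HZ.
by move=> [h Hh [z Zz <-]]; exists (sub_elt Hh), z.
Qed.

(** Central summands disappear from every product and bracket of [X], leaving
    one of elements of [H]. *)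
Lemma supplement_commutator :
  commutator_of X `<=` val @` commutator_of (awb_sub H).
Proof.
apply: commutator_sub => [|a b|a b].
- exact/(image_subspace (val_hom H))/commutator_subspace.
- have [h [z [Zz ->]]] := supplement_dec a; have [k [t [Zt ->]]] := supplement_dec b.
  rewrite (center_ops _ _ Zz Zt).1.
  by exists (amul h k) => //; apply: amul_commutator.
- have [h [z [Zz ->]]] := supplement_dec a; have [k [t [Zt ->]]] := supplement_dec b.
  rewrite (center_ops _ _ Zz Zt).2.
  by exists (abr h k) => //; apply: abr_commutator.
Qed.

(** What annihilates [H] also annihilates [H + Z], since [Z] annihilates all. *)
Lemma supplement_center (u : awb_sub H) :
  center_of (awb_sub H) u -> center_of X (val u).
Proof.
move=> Zu x; have [h [z [Zz ->]]] := supplement_dec x.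
have [zu uz bzu buz] := Zz (val u).
rewrite !amulDl !amulDr !abrDl !abrDr zu uz bzu buz !addr0.
by have [uh hu buh bhu] := Zu h; split; [move: uh|move: hu|move: buh|move: bhu]; move/(congr1 val).
Qed.

(** A quotient of a subalgebra can be realised as a subalgebra of a quotient:
    [N], being central in [X], is an ideal of [X]. *)
Lemma quotient_subalgebra (N : ideal (awb_sub H)) :
  N `&` commutator (awb_sub H) = [set 0] ->
  exists (M : ideal X) (I : subalgebra (awb_quot M)),
    [/\ M `&` commutator X = [set 0],
        sumset I (center (awb_quot M)) = [set: awb_quot M] &
        awb_isomorphic (awb_sub I) (awb_quot N)].
Proof.
move=> N0.
pose S := val @` ideal_set N : set X.
have sS : is_subspace S by apply: (image_subspace (val_hom H)); apply: ideal_subspace.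
have SZ : S `<=` center_of X.
  move=> _ [u Nu <-]; apply/supplement_center/(trivial_ideal_central N0) => //.
pose M := central_ideal sS SZ.
have hm : awb_hom (coset M \o (val : awb_sub H -> X)).
  exact: comp_hom (coset_hom M) (val_hom H).
exists M, (range_subalg hm); split.
- apply/seteqP; split; last first.
    by move=> _ ->; split; [apply: (ideal_subspace M).1 | apply: (commutator_subspace X).1].
  move=> _ [[u Nu <-] /supplement_commutator[v Cv /val_inj vu]].
  have : (N `&` commutator (awb_sub H)) u by split=> //; rewrite -vu.
  by rewrite N0 => ->.
- apply/seteqP; split=> // u _; have [x <-] := coset_surj u.
  have [h [z [Zz ->]]] := supplement_dec x.
  exists (coset M (val h)); first by exists h.
  exists (coset M z); last by rewrite (homD (coset_hom M)).
  exact: surj_center (coset_hom M) (@coset_surj _ _ M) Zz.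
- have [|||||f [isof _]] := @iso_of_span _ _ _ _ (corestr hm) (coset N).
  + exact: corestr_hom.
  + exact: coset_hom.
  + exact: corestr_surj.
  + exact: coset_surj.
  + move=> w; rewrite coset_eq0; split.
      by move/(congr1 val)/coset_eq0 => [v Nv /val_inj <-].
    by move=> Nw; apply: val_inj; apply/coset_eq0; exists w.
  + by exists f.
Qed.

End Supplement.

(** * Isoclinism as existence of a span *)

Section Isoclinism.
Context {K : fieldType} (G1 G2 : awbType K).

(** Only the restrictions of [p] and [q] to the commutator are compared;
    elsewhere [p w = 0] merely forces [q w] to be central. *)
Definition isoclinic_span (P : awbType K) (p : P -> G1) (q : P -> G2) : Prop :=
  [/\ awb_hom p /\ awb_hom q, surj p /\ surj q &
      forall w, commutator_of P w -> p w = 0 <-> q w = 0].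

(** The maps [eta] and [xi] are induced by [p w |-> q w], which is well defined
    modulo the centers and on the commutators; the compatibility condition
    holds because products and brackets only see classes modulo the center. *)
Lemma isoclinic_of_span (P : awbType K) (p : P -> G1) (q : P -> G2) :
  isoclinic_span p q -> isoclinic G1 G2.
Proof.
move=> [[hp hq] [sp sq] pq0].
have [_ p2 p3] := hp; have [_ q2 q3] := hq.
(* [p w] is central iff [p] kills the products and brackets of [w] in [P]. *)
have Zpq w : center_of G1 (p w) <-> center_of G2 (q w).
  split=> Zw b.
    have [v <-] := sq b; have [] := Zw (p v).
    rewrite -!p2 -!p3 -!q2 -!q3.
    by split; apply/pq0 => //; try exact: amul_commutator; exact: abr_commutator.
  have [v <-] := sp b; have [] := Zw (q v).
  rewrite -!p2 -!p3 -!q2 -!q3.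
  by split; apply/pq0 => //; try exact: amul_commutator; exact: abr_commutator.
have [|||||eta [iso_eta etaE]] :=
    @iso_of_span _ _ _ _ (coset (center G1) \o p) (coset (center G2) \o q).
- exact: comp_hom (coset_hom _) hp.
- exact: comp_hom (coset_hom _) hq.
- by move=> u; have [x <-] := coset_surj u; have [w <-] := sp x; exists w.
- by move=> u; have [x <-] := coset_surj u; have [w <-] := sq x; exists w.
- by move=> w /=; rewrite !coset_eq0; apply: Zpq.
have [|||||xi [iso_xi xiE]] := @iso_of_span _ _ _ _ (comm_map hp) (comm_map hq).
- exact: comm_map_hom.
- exact: comm_map_hom.
- exact: comm_map_surj.
- exact: comm_map_surj.
- move=> w; have pqw := pq0 _ (awb_subP w).
  by split=> /(congr1 val) /= /pqw e; apply: val_inj.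
exists eta, xi; split=> // g g' h h'.
have [w <-] := sp g; have [w' <-] := sp g'.
rewrite (etaE w) (etaE w') /= => /esym/coset_eqP Zh /esym/coset_eqP Zh'.
have [hh bhh] : amul h h' = amul (q w) (q w') /\ abr h h' = abr (q w) (q w').
  by have := center_ops (q w) (q w') Zh Zh'; rewrite ![q _ + _]addrC !subrK.
have -> : comm_abr (p w) (p w') = comm_map hp (comm_abr w w').
  by apply: val_inj; rewrite /= p3.
have -> : comm_amul (p w) (p w') = comm_map hp (comm_amul w w').
  by apply: val_inj; rewrite /= p2.
by rewrite !xiE; split; apply: val_inj; rewrite /= ?q2 ?q3 ?hh ?bhh.
Qed.

(** The span is the fibre product over the quotients by the centers.  By
    compatibility its products and brackets are pairs [(c, xi c)], so one
    component of such a pair vanishes iff the other does. *)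
Lemma span_of_isoclinic : isoclinic G1 G2 ->
  exists (P : awbType K) (p : P -> G1) (q : P -> G2), isoclinic_span p q.
Proof.
move=> [eta [xi [[[eta1 eta2 eta3] beta] [hxi bxi] compat]]].
have [c11 c12 c13] := coset_hom (center G1).
have [c21 c22 c23] := coset_hom (center G2).
have [x1 x2 x3] := hxi.
have heta : awb_hom eta by [].
pose R : set (G1 * G2) :=
  [set w | eta (coset (center G1) w.1) = coset (center G2) w.2].
have sR : is_subspace R.
  split; first by rewrite /R /= (hom0 (coset_hom _)) (hom0 heta) (hom0 (coset_hom _)).
  by move=> k x y; rewrite /R /= c11 c21 eta1 => -> ->.
have mR x y : R x -> R y -> R (amul x y).
  by rewrite /R /= c12 c22 eta2 => -> ->.
have bR x y : R x -> R y -> R (abr x y).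
  by rewrite /R /= c13 c23 eta3 => -> ->.
pose P := awb_sub (Subalgebra sR mR bR).
have RP : forall w : P, R (val w) := @awb_subP _ _ _.
have hp : awb_hom (fst \o val : P -> G1) := comp_hom (@fst_hom _ _ _) (val_hom _).
have hq : awb_hom (snd \o val : P -> G2) := comp_hom (@snd_hom _ _ _) (val_hom _).
exists P, (fst \o val), (snd \o val); split; [by split| split |].
- move=> g; have [h Eh] := coset_surj (eta (coset (center G1) g)).
  have Rgh : R (g, h) by rewrite /R /= Eh.
  by exists (@sub_elt _ _ (Subalgebra sR mR bR) _ Rgh).
- have [eta' _ eta'K] := beta.
  move=> h; have [g Eg] := coset_surj (eta' (coset (center G2) h)).
  have Rgh : R (g, h) by rewrite /R /= Eg eta'K.
  by exists (@sub_elt _ _ (Subalgebra sR mR bR) _ Rgh).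
have graph : commutator_of P `<=`
    [set w | exists c, val c = (val w).1 /\ val (xi c) = (val w).2].
  apply: commutator_sub.
  - split; first by exists 0; rewrite (hom0 hxi).
    move=> k x y [c [c1 c2]] [d [d1 d2]]; exists (k *: c + d).
    by rewrite x1 !linearP /= c1 c2 d1 d2.
  - move=> a b; exists (comm_amul (val a).1 (val b).1); split=> //.
    by have [_ ->] := compat _ _ _ _ (RP a) (RP b).
  - move=> a b; exists (comm_abr (val a).1 (val b).1); split=> //.
    by have [-> _] := compat _ _ _ _ (RP a) (RP b).
move=> w /graph[c [/= <- <-]].
have [xi' xiK _] := bxi.
split=> e.
  have -> : c = 0 by apply: val_inj.
  by rewrite (hom0 hxi).
have /(can_inj xiK)-> // : xi c = xi 0.
by apply: val_inj; rewrite (hom0 hxi).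
Qed.

End Isoclinism.

(** * The three equivalent conditions *)

Section Corollary.
Context {K : fieldType} (G1 G2 : awbType K).

(** Taking [A := P/[[P,P]]] rather than [G2/[[G2,G2]]] is what makes the map
    [P -> G1 x A] have its kernel inside that of [q]: an element of the kernel
    is in [[P,P]] and killed by [p]. *)
Lemma isoclinic_subquotient : isoclinic G1 G2 ->
  exists (A : awbType K) (H : subalgebra (G1 * A)%type) (N : ideal (awb_sub H)),
    [/\ trivial_commutator A,
        sumset H (center (G1 * A)%type) = [set: G1 * A],
        N `&` commutator (awb_sub H) = [set 0] &
        awb_isomorphic (awb_quot N) G2].
Proof.
move=> /span_of_isoclinic[P [p [q [[hp hq] [sp sq] pq0]]]].
pose A := awb_quot (commutator P).
have he : awb_hom (fun w => (p w, coset (commutator P) w)).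
  exact: pair_hom hp (coset_hom _).
pose H := range_subalg he; pose e : P -> awb_sub H := corestr he.
have hc : awb_hom e := corestr_hom he.
have sc : surj e := @corestr_surj _ _ _ _ he.
have tA : trivial_commutator A := @quot_commutator_trivial _ P.
have ker_e w : e w = 0 -> q w = 0.
  move=> /(congr1 val)/= ew; have := congr1 snd ew => /= /coset_eq0 Cw.
  exact: (pq0 _ Cw).1 (congr1 fst ew).
pose N := image_ideal hc sc (ker_ideal hq).
exists A, H, N; split=> //.
(* [0 x A] is central, because [A] has trivial operations. *)
- apply/seteqP; split=> // -[g a] _.
  have [w pw] := sp g.
  exists (p w, coset (commutator P) w); first by exists w.
  exists (0, a - coset (commutator P) w); last first.
    by rewrite -[LHS]/(p w + 0, _ + (_ - _)) pw addr0 addrC subrK.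
  move=> [g' a']; have t0 := (trivial_commutatorP A).1 tA.
  by split; apply: injective_projections => /=;
    rewrite ?(amul0l, amul0r, abr0l, abr0r) //; case: (t0 (a - coset _ w) a'); case: (t0 a' (a - coset _ w)).
- apply/seteqP; split; last first.
    by move=> _ ->; split; [apply: (ideal_subspace N).1 | apply: (commutator_subspace _).1].
  move=> _ [[v qv <-]] /(surj_commutator hc sc)[w Cw ew].
  rewrite -ew; apply: val_inj => /=.
  have qw : q w = 0.
    have : q (w - v) = 0 by apply: ker_e; rewrite (homB hc) ew subrr.
    by rewrite (homB hq) (qv : q v = 0) subr0.
  by rewrite ((pq0 _ Cw).2 qw) ((coset_eq0 (commutator P) w).2 Cw).
- have [|||||f [isof _]] := @iso_of_span _ _ _ _ (coset N \o e) q => //.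
  + exact: comp_hom (coset_hom N) hc.
  + by move=> u; have [x <-] := coset_surj u; have [w <-] := sc x; exists w.
  + move=> w /=; rewrite coset_eq0; split; last by exists w.
    case=> v qv /esym/eqP; rewrite -subr_eq0 -(homB hc) => /eqP/ker_e/eqP.
    by rewrite (homB hq) (qv : q v = 0) subr0 => /eqP.
  + by exists f.
Qed.

(** Projecting the preimage of [I] to [G1] need not be surjective, since [I] is
    only a supplement of the center; so the span allows a central discrepancy
    between [x + M] and [i].  Products and brackets do not see it, hence on the
    commutator of the span [x + M = i], and [x] is in [[G1,G1]] x 0. *)
Lemma isoclinic_of_quotient_subalgebra (B : awbType K) (M : ideal (G1 * B)%type)
    (I : subalgebra (awb_quot M)) :
  trivial_commutator B -> M `&` commutator (G1 * B)%type = [set 0] ->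
  sumset I (center (awb_quot M)) = [set: awb_quot M] ->
  awb_isomorphic (awb_sub I) G2 -> isoclinic G1 G2.
Proof.
move=> tB M0 IZ [f [hf [f' fK f'K]]].
have t0 := (trivial_commutatorP B).1 tB.
have [m1 m2 m3] := coset_hom M.
pose R : set ((G1 * B) * awb_sub I) :=
  [set w | center_of (awb_quot M) (coset M w.1 - val w.2)].
have hd : linear (fun w : (G1 * B) * awb_sub I => coset M w.1 - val w.2).
  have [v1 _ _] := val_hom I.
  by move=> k x y; rewrite m1 v1 scalerBr opprD addrACA.
have opsR x y : R x -> R y ->
    coset M (amul x y).1 = val (amul x y).2 /\ coset M (abr x y).1 = val (abr x y).2.
  move=> Rx Ry; have := center_ops (val x.2) (val y.2) Rx Ry.
  by rewrite ![val _ + _]addrC !subrK -m2 -m3.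
have sR : is_subspace R.
  split=> [|k x y Rx Ry]; last by rewrite /R /= hd; apply: (center_subspace _).2.
  by rewrite /R /= (hom0 (coset_hom M)) subrr; apply: (center_subspace _).1.
have mR x y : R x -> R y -> R (amul x y).
  move=> Rx Ry; rewrite /R /= (opsR _ _ Rx Ry).1 subrr.
  exact: (center_subspace _).1.
have bR x y : R x -> R y -> R (abr x y).
  move=> Rx Ry; rewrite /R /= (opsR _ _ Rx Ry).2 subrr.
  exact: (center_subspace _).1.
pose RA := Subalgebra sR mR bR; pose P := awb_sub RA.
have RP : forall w : P, R (val w) := @awb_subP _ _ _.
pose x (w : P) := (val w).1; pose i (w : P) := (val w).2.
have hx : awb_hom x := comp_hom (@fst_hom _ _ _) (val_hom _).
have hi : awb_hom i := comp_hom (@snd_hom _ _ _) (val_hom _).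
have [x1 _ _] := hx; have [i1 _ _] := hi; have [v1 _ _] := val_hom I.
apply: (@isoclinic_of_span _ _ _ P (fst \o x) (f \o i)); split.
- by split; [apply: comp_hom (@fst_hom _ _ _) hx | apply: comp_hom].
- split.
    move=> g; have [j [z [Zz Ej]]] := supplement_dec IZ (coset M (g, 0)).
    have Rw : R ((g, 0), j) by rewrite /R /= Ej addrC addKr.
    by exists (@sub_elt _ _ RA _ Rw).
  move=> h; have [y Ey] := coset_surj (val (f' h)).
  have Rw : R (y, f' h) by rewrite /R /= Ey subrr; apply: (center_subspace _).1.
  by exists (@sub_elt _ _ RA _ Rw); rewrite /= f'K.
have graph : commutator_of P `<=` [set w | (x w).2 = 0 /\ coset M (x w) = val (i w)].
  apply: commutator_sub => [|a b|a b].
  - split=> [|k a b [a1 a2] [b1 b2]]; split.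
    + by rewrite (hom0 hx).
    + by rewrite (hom0 hx) (hom0 hi) (hom0 (coset_hom M)).
    + by rewrite x1 -[LHS]/(k *: (x a).2 + (x b).2) a1 b1 scaler0 addr0.
    + by rewrite x1 i1 m1 v1 a2 b2.
  - by split; [apply: (t0 _ _).1 | apply: (opsR _ _ (RP a) (RP b)).1].
  - by split; [apply: (t0 _ _).2 | apply: (opsR _ _ (RP a) (RP b)).2].
move=> w Cw; have [xw2 xiw] := graph w Cw; split=> /= [xw1|].
  have xw : x w = 0 by apply: injective_projections.
  have iw : i w = 0 by apply: val_inj; rewrite -xiw xw (hom0 (coset_hom M)).
  by rewrite iw (hom0 hf).
rewrite -(hom0 hf) => /(can_inj fK) iw.
have : (M `&` commutator (G1 * B)%type) (x w).
  split; last exact: hom_commutator hx Cw.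
  by apply/coset_eq0; rewrite xiw iw.
by rewrite M0 => ->.
Qed.

End Corollary.

Theorem corollary3p13 (K : fieldType) (G1 G2 : awbType K) :
  [<->
    (* (a) *)
    isoclinic G1 G2;
    (* (b) *)
    exists (A : awbType K) (H : subalgebra (G1 * A)%type) (N : ideal (awb_sub H)),
      [/\ trivial_commutator A,
          sumset H (center (G1 * A)%type) = [set: G1 * A],
          N `&` commutator (awb_sub H) = [set 0] &
          awb_isomorphic (awb_quot N) G2];
    (* (c) *)
    exists (B : awbType K) (M : ideal (G1 * B)%type) (I : subalgebra (awb_quot M)),
      [/\ trivial_commutator B,
          M `&` commutator (G1 * B)%type = [set 0],
          sumset I (center (awb_quot M)) = [set: awb_quot M] &
          awb_isomorphic (awb_sub I) G2]
  ].
Proof.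
tfae.
- exact: isoclinic_subquotient.
- move=> [A [H [N [tA HZ N0 iso]]]].
  have [M [I [M0 IZ iso']]] := quotient_subalgebra HZ N0.
  by exists A, M, I; split=> //; apply: awb_isomorphic_trans iso' iso.
- by move=> [B [M [I [tB M0 IZ iso]]]]; apply: isoclinic_of_quotient_subalgebra iso.
Qed.
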